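(* Let $m\ge1$ and $m+2\le n\le 2m+2$, and let $\widehat Y_{m,n}$ be the minimal Fano lift defined in the context (a smooth toric Fano variety of dimension $2m+n$). Then $$\bigl(\tau_{\widehat Y_{m,n}}(\mathbb Z),\tau_{\widehat Y_{m,n}}(\mathbb Q)\bigr)=\begin{cases}(4,4), & (m,n)=(1,3),\\ \left(3,\,3+\frac1m\right), & m\ge2,\ m+2\le n\le 2m+1,\\ \left(3,\,3+\frac1{m+1}\right), & n=2m+2.\end{cases}$$ In particular, every such $\widehat Y_{m,n}$ has positive Gongyo-index gap $\delta(\widehat Y_{m,n})>0$ except when $(m,n)=(1,3)$.
   Context: All toric varieties are over an algebraically closed field. Gongyo indices. For a smooth projective toric variety $X$, a nonzero class $D\in\mathrm{Nef}(X)\cap\mathrm{Pic}(X)$ and $\mathbb K\in\{\mathbb Z,\mathbb Q\}$, put $$\tau_X(D;\mathbb K)=\sup\Big\{\sum_{i=1}^r a_i\ \Big|\ D=\sum_{i=1}^r a_iD_i,\ 0\ne D_i\in\mathrm{Nef}(X)\cap\mathrm{Pic}(X),\ a_i\in\mathbb K_{>0}\Big\}$$ (for $\mathbb K=\mathbb Q$ the equality is in $\mathrm{Pic}(X)\otimes\mathbb Q$), and $\delta_X(D)=\tau_X(D;\mathbb Q)-\tau_X(D;\mathbb Z)$. If $-K_X$ is nef and nonzero, $\tau_X(\mathbb K):=\tau_X(-K_X;\mathbb K)$ and $\delta(X):=\delta_X(-K_X)$. A primitive collection of a smooth complete fan is a set of primitive ray generators that does not span a cone although every proper subset does; a set of ray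 generators spans a cone iff it contains no primitive collection. The model $Y_{m,n}$. Let $N\simeq\mathbb Z^{2m+1}$ and $x_1,\dots,x_{2m+2}\in N$ with $x_1,\dots,x_{2m+1}$ a basis and $x_1+\cdots+x_{2m+2}=0$; put $y_i=-x_i$ ($1\le i\le n$). $Y_{m,n}$ is the smooth projective toric weak Fano $(2m+1)$-fold whose fan has primitive ray generators $x_1,\dots,x_{2m+2},y_1,\dots,y_n$ and whose primitive collections are exactly $\{x_i,y_i\}$ ($1\le i\le n$); $\{x_j\mid j\in\{1,\dots,2m+2\}\setminus I\}$ for $I\subset\{1,\dots,n\}$, $|I|=m$; and $\{y_j\mid j\in J\}$ for $J\subset\{1,\dots,n\}$, $|J|=m+1$. The construction $H(x,p)$. Let $X=X_\Sigma$ be a smooth projective toric variety with lattice $N$, $x$ a primitive ray generator of $\Sigma$ and $p\ge2$. In $\widehat N=N\oplus\mathbb Z^{p-1}$ let $z_1,\dots,z_{p-1}$ be the standard basis of the second summand and $z_p:=x-z_1-\cdots-z_{p-1}$. $H(x,p)(X)$ is the smooth projective toric variety of dimension $\dim X+p-1$ whose fan in $\widehat N$ has as primitive ray generators those of $\Sigma$ with $x$ replaced by $z_1,\dots,z_p$, and as primitive collections exactly the primitive collections $P$ of $\Sigma$ with $x\notin P$, together with $(P\setminus\{x\})\cup\{z_1,\dots,z_p\}$ for the primitive collections $P\ni x$. The minimal lift $\widehat Y_{m,n}$. Choose $T\subset\{2,\dots,n\}$ with $|T|=m-1$ and put $S=\{2,\dots,n\}\setminus T$. $\widehat Y_{m,n}$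 is obtained from $Y_{m,n}$ by applying $H(x_i,2)$ for all $i\in T$ and $H(y_j,2)$ for all $j\in S$ (in any order), leaving all other rays unchanged. Up to toric isomorphism it does not depend on the choice of $T$. *)

(* Defs.v *)
From HB Require Import structures.
From mathcomp Require Import all_boot all_order all_algebra.
From mathcomp Require Import classical_sets reals constructive_ereal ereal.

Set Implicit Arguments.
Unset Strict Implicit.
Unset Printing Implicit Defensive.

Import Order.TTheory GRing.Theory Num.Theory.

Local Open Scope ring_scope.

(* The fan of a smooth complete toric variety, recorded by its lattice rank,
   its primitive ray generators and its primitive collections.  The type [ray]
   only labels the rays.  That the data do form a smooth complete fan is not
   part of the record. *)
Record fan := Fan {
  dim : nat;
  ray : finType;
  gen : ray -> 'rV[int]_dim;
  pcoll : {set {set ray}}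
}.

Definition spans_cone (F : fan) (A : {set ray F}) : bool :=
  [forall P in pcoll F, ~~ (P \subset A)].

(* Torus-invariant divisors \sum_r (D r) D_r. *)
Definition divisor (F : fan) := {ffun ray F -> int}.

Definition pairing (K : numDomainType) (d : nat) (u : 'rV[K]_d)
    (v : 'rV[int]_d) : K :=
  \sum_j u 0 j * (v 0 j)%:~R.

(* Equality in Pic(X) (x) K, where Pic(X) is the cokernel of M -> Z^rays,
   u |-> \sum_r <u, gen r> D_r, with M the dual lattice.  For K = int this is
   linear equivalence. *)
Definition pic_eq (K : numDomainType) (F : fan) (D E : ray F -> K) : Prop :=
  exists u : 'rV[K]_(dim F), forall r, D r - E r = pairing u (gen r).

Definition pic_nonzero (F : fan) (D : divisor F) : Prop :=
  ~ @pic_eq int F D (fun=> 0).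

(* W is (the set of rays of) a cone of codimension one, a facet of the two
   maximal cones obtained by adding r1 or r2, and
     gen r1 + gen r2 + \sum_(r in W) b r * gen r = 0
   is its wall relation. *)
Definition wall_relation (F : fan) (W : {set ray F}) (r1 r2 : ray F)
    (b : ray F -> int) : Prop :=
  [/\ #|W|.+1 = dim F, [/\ r1 != r2, r1 \notin W & r2 \notin W],
      spans_cone (r1 |: W), spans_cone (r2 |: W) &
      gen r1 + gen r2 + \sum_(r in W) b r *: gen r = 0].

(* The intersection number D . V(W) with the torus-invariant curve V(W):
   D_r1 . V(W) = D_r2 . V(W) = 1, D_r . V(W) = b r for r in W, and the other
   D_r are disjoint from V(W). *)
Definition curve_degree (F : fan) (D : divisor F) (W : {set ray F})
    (r1 r2 : ray F) (b : ray F -> int) : int :=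
  D r1 + D r2 + \sum_(r in W) b r * D r.

(* Every effective curve on a complete toric variety is numerically a
   nonnegative combination of the curves V(W). *)
Definition nef (F : fan) (D : divisor F) : Prop :=
  forall (W : {set ray F}) (r1 r2 : ray F) (b : ray F -> int),
    wall_relation W r1 r2 b -> 0 <= curve_degree D W r1 r2 b.

Definition anticanonical (F : fan) : divisor F := [ffun=> 1].

Definition nef_decomposition (K : numDomainType) (F : fan) (D : divisor F)
    (k : nat) (a : 'I_k -> K) (E : 'I_k -> divisor F) : Prop :=
  [/\ forall i, 0 < a i,
      forall i, nef (E i),
      forall i, pic_nonzero (E i) &
      pic_eq (fun r => (D r)%:~R) (fun r => \sum_(i < k) a i * (E i r)%:~R)].

Definition tau_div (R : realType) (K : numDomainType) (emb : K -> R)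
    (F : fan) (D : divisor F) : \bar R :=
  ereal_sup [set t : \bar R | exists (k : nat) (a : 'I_k -> K)
      (E : 'I_k -> divisor F),
    nef_decomposition D a E /\ t = (emb (\sum_(i < k) a i))%:E]%classic.

Definition tau_divZ (R : realType) (F : fan) (D : divisor F) : \bar R :=
  tau_div (fun z : int => z%:~R : R) D.

Definition tau_divQ (R : realType) (F : fan) (D : divisor F) : \bar R :=
  tau_div (fun q : rat => ratr q : R) D.

Definition delta_div (R : realType) (F : fan) (D : divisor F) : \bar R :=
  (tau_divQ R D - tau_divZ R D)%E.

Definition tauZ (R : realType) (F : fan) : \bar R :=
  tau_divZ R (anticanonical F).
Definition tauQ (R : realType) (F : fan) : \bar R :=
  tau_divQ R (anticanonical F).
Definition delta (R : realType) (F : fan) : \bar R :=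
  delta_div R (anticanonical F).

(* H(x,p), for 2 <= p.  The new rays z_1, ..., z_(p-1) are labelled by
   [inr _], and [inl x] labels z_p = x - z_1 - ... - z_(p-1); [inl r] labels
   the old ray r for r != x. *)
Section Hconstruction.
Variables (F : fan) (x : ray F) (p : nat).

Definition H_gen (r : ray F + 'I_p.-1) : 'rV[int]_(dim F + p.-1) :=
  match r with
  | inl r0 => row_mx (gen r0) (if r0 == x then const_mx (-1) else 0)
  | inr i => row_mx 0 (delta_mx 0 i)
  end.

Definition H_set (P : {set ray F}) : {set ray F + 'I_p.-1} :=
  if x \in P then inl @: P :|: inr @: [set: 'I_p.-1] else inl @: P.

Definition Hfan : fan := Fan H_gen (H_set @: pcoll F).
End Hconstruction.

(* Successive H(r,2) along a sequence s of labels of rays of F. *)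
Fixpoint H2_seq (B : Type) (s : seq B) (F : fan) (lab : B -> ray F) : fan :=
  if s is r :: s' then
    H2_seq s' (fun r' => inl (lab r') : ray (Hfan (lab r) 2))
  else F.

(* Y_(m,n), for n <= 2m+2.  Indices start at 0: with the usual 1-based indices,
   [inl i] is x_(i+1) and [inr i] is y_(i+1). *)
Section Ymodel.
Variables m n : nat.

Definition x_vec (k : nat) : 'rV[int]_(m.*2.+1) :=
  \row_j (if (k < m.*2.+1)%N then (k == j :> nat)%:R else -1).

Definition Y_ray : finType := ('I_m.*2.+2 + 'I_n)%type.

Definition Y_gen (r : Y_ray) : 'rV[int]_(m.*2.+1) :=
  match r with inl i => x_vec i | inr i => - x_vec i end.

(* The index i < n as an index of the x's. *)
Definition x_idx (i : 'I_n) : 'I_m.*2.+2 := inord i.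

Definition x_ray (i : 'I_n) : Y_ray := inl (x_idx i).
Definition y_ray (i : 'I_n) : Y_ray := inr i.

Definition Y_pcoll : {set {set Y_ray}} :=
  [set [set x_ray i; y_ray i] | i : 'I_n]
  :|: [set inl @: (~: (x_idx @: I)) | I : {set 'I_n} & #|I| == m]
  :|: [set y_ray @: J | J : {set 'I_n} & #|J| == m.+1].

Definition Yfan : fan := Fan Y_gen Y_pcoll.

(* {2, ..., n} in 1-based indices. *)
Definition idx_ge2 : {set 'I_n} := [set i : 'I_n | (0 < i)%N].

(* The rays at which H(-,2) is applied to obtain the minimal lift: x_i for
   i in T, and y_j for j in {2, ..., n} \ T. *)
Definition lifted_rays (T : {set 'I_n}) : seq Y_ray :=
  [seq x_ray i | i <- enum T] ++ [seq y_ray j | j <- enum (idx_ge2 :\: T)].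

(* The minimal lift, s being an ordering of [lifted_rays T]. *)
Definition Yhat (s : seq Y_ray) : fan := @H2_seq Y_ray s Yfan id.
End Ymodel.

(* Main.v *)
Require Import Defs.
From mathcomp Require Import all_boot all_order all_algebra.
From mathcomp Require Import reals constructive_ereal ereal.
From mathcomp Require Import ring lra zify.

(** The variety [H(x,p)] replaces a ray by rays that sum to it.  Hence adding up
    the coefficients of a divisor over the new rays ([push]) identifies the
    Picard group of the lift with that of the base, and it also identifies the
    nef cones ([nef_push], [basepoint_free_lift]): a wall of the base lifts to a
    wall with the pulled back relation, and an effective representative missing
    a given cone lifts as well.  Only the anticanonical class changes.

    On [Y_(m,n)] a divisor class is determined by [s = sum_i D x_i] and
    [t_i = D x_i + D y_i] ([Y_pic_eqP]).  The primitive relations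
    [sum_(i notin I) x_i = sum_(i in I) y_i], [#|I| = m], and
    [sum_(j in J) y_j = sum_(j notin J) x_j], [#|J| = m + 1], say that on a nef
    class any [m] of the [t_i] sum to at most [s] and any [m + 1] of them to at
    least [s].  A nonzero integral nef class therefore has at most one [t_i]
    equal to [0] ([nef_pair_deg_ge1]), so [s >= m] and
    [sum_i t_i - s >= n - m - 1].

    The anticanonical class of the lift has [s = 3m + 1] and
    [t = (2, 3, ..., 3)].  With [q = max(m, n - m - 1)], evaluating the two
    linear inequalities on it shows that a decomposition of total weight [W] has
    [q (W - 3) <= 1] ([weight_le]).  Conversely the classes
    [e_k = (m; 1 - delta_k)], [f_m = (m; 1)] and [f_(m+1) = (m + 1; 1)], written
    [(s; t)], are base point free, and for every [W >= 3] with [q (W - 3) <= 1]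
    they have a nonnegative combination of total weight [W] that is the
    anticanonical class ([exists_nef_decomposition]).  So each Gongyo index is
    the largest such [W] in the coefficient ring ([tau_lift]): [3 + 1/q] over
    the rationals, and [3] over the integers, or [4] when [q = 1].
    Finally [q = m], except that [q = m + 1] when [n = 2m + 2]; hence [q = 1]
    only for [(m, n) = (1, 3)]. *)

Set Implicit Arguments.
Unset Strict Implicit.
Unset Printing Implicit Defensive.

Import Order.TTheory GRing.Theory Num.Theory.

Local Open Scope ring_scope.

(** * Picard classes and walls *)

Lemma pic_eq_ext (K : numDomainType) (F : fan) (D D' E E' : ray F -> K) :
  D =1 D' -> E =1 E' -> pic_eq D E -> pic_eq D' E'.
Proof. by move=> eD eE [u hu]; exists u => r; rewrite -eD -eE. Qed.

Lemma pairing_sum (K : numDomainType) (d : nat) (I : finType) (u : 'rV[K]_d)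
    (b : I -> int) (v : I -> 'rV[int]_d) :
  pairing u (\sum_i b i *: v i) = \sum_i (b i)%:~R * pairing u (v i).
Proof.
under [RHS]eq_bigr do rewrite mulr_sumr.
rewrite exchange_big; apply: eq_bigr => j _ /=.
rewrite summxE rmorph_sum mulr_sumr; apply: eq_bigr => i _ /=.
by rewrite mxE rmorphM /= mulrCA.
Qed.

Lemma pairing0 (K : numDomainType) (d : nat) (u : 'rV[K]_d) :
  pairing u 0 = 0.
Proof. by rewrite /pairing big1 // => j _; rewrite mxE mulr0. Qed.

Lemma pairingN (K : numDomainType) (d : nat) (u : 'rV[K]_d) (v : 'rV[int]_d) :
  pairing u (- v) = - pairing u v.
Proof.
by rewrite /pairing -sumrN; apply: eq_bigr => j _; rewrite mxE rmorphN mulrN.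
Qed.

(** The wall relation with its two coefficients [1] and its zero coefficients
    made explicit, so that it and the curve degree become sums over all rays. *)
Definition wall_coef (F : fan) (W : {set ray F}) (r1 r2 : ray F)
    (b : ray F -> int) (r : ray F) : int :=
  if r \in W then b r else ((r == r1) || (r == r2))%:R.

Section WallCoef.
Variables (F : fan) (W : {set ray F}) (r1 r2 : ray F) (b : ray F -> int).
Hypotheses (r12 : r1 != r2) (r1W : r1 \notin W) (r2W : r2 \notin W).

Lemma sum_wall_coef_out (V : lmodType int) (f : ray F -> V) :
  \sum_(r in ~: W) wall_coef W r1 r2 b r *: f r = f r1 + f r2.
Proof.
rewrite (bigD1 r1) ?inE //= (bigD1 r2) ?inE ?r2W 1?eq_sym //=.
rewrite /wall_coef (negPf r1W) (negPf r2W) !eqxx orbT !scale1r big1 ?addr0 //.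
move=> r /andP[/andP[]]; rewrite inE => /negPf -> /negPf -> /negPf ->.
by rewrite scale0r.
Qed.

Lemma sum_wall_coef (V : lmodType int) (f : ray F -> V) :
  \sum_r wall_coef W r1 r2 b r *: f r = f r1 + f r2 + \sum_(r in W) b r *: f r.
Proof.
rewrite (bigID (mem W)) /= addrC -sum_wall_coef_out; congr (_ + _).
  by apply: eq_bigl => r; rewrite inE.
by apply: eq_bigr => r rW; rewrite /wall_coef rW.
Qed.

Lemma curve_degreeE (D : divisor F) :
  curve_degree D W r1 r2 b = \sum_r wall_coef W r1 r2 b r * D r.
Proof. by have /= := @sum_wall_coef int^o D; rewrite /curve_degree => <-. Qed.
End WallCoef.

(** On a complete toric variety nef divisors are base point free; this form of
    the condition can be checked from a few effective representatives and needs
    no list of the walls. *)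
Definition basepoint_free (F : fan) (D : divisor F) : Prop :=
  forall A : {set ray F}, spans_cone A ->
    exists D' : ray F -> int,
      [/\ pic_eq D D', forall r, 0 <= D' r & forall r, r \in A -> D' r = 0].

(** A representative vanishing on the maximal cone [r1 |: W] meets the curve
    [V(W)] only along the ray [r2], where its coefficient is nonnegative. *)
Lemma basepoint_free_nef (F : fan) (D : divisor F) :
  basepoint_free D -> nef D.
Proof.
move=> bpfD W r1 r2 b [_ [r12 r1W r2W] W1 W2 rel].
have [D' [[u hu] D'_ge0 D'A]] := bpfD _ W1.
rewrite curve_degreeE //; set c := wall_coef _ _ _ _.
have -> : \sum_r c r * D r = \sum_r c r * D' r.
  apply/eqP; rewrite -subr_eq0 -sumrB; apply/eqP.
  transitivity (pairing u (\sum_r c r *: gen r)).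
    rewrite pairing_sum; apply: eq_bigr => r _.
    by rewrite -mulrBr hu intz.
  by rewrite sum_wall_coef // rel pairing0.
apply: sumr_ge0 => r _; rewrite /c /wall_coef.
case: ifPn => rW; first by rewrite D'A ?mulr0 // !inE rW orbT.
by rewrite mulr_ge0 // ler0n.
Qed.

(** * Lifts of fans *)

Definition push (V : nmodType) (R S : finType) (pi : R -> S) (D : R -> V) :
    S -> V :=
  fun s => \sum_(r | pi r == s) D r.

Lemma push_ext (V : nmodType) (R S : finType) (pi : R -> S) (D E : R -> V) :
  D =1 E -> push pi D =1 push pi E.
Proof. by move=> eDE s; apply: eq_bigr. Qed.

Lemma push_comp (V : nmodType) (R S U : finType) (pi : R -> S) (pi' : S -> U)
    (D : R -> V) : push (pi' \o pi) D =1 push pi' (push pi D).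
Proof.
move=> t; rewrite /push (partition_big pi (fun s => pi' s == t)) //=.
apply: eq_bigr => s /eqP <-; apply: eq_bigl => r.
by rewrite andbC /=; case: (pi r =P s) => [->|]; rewrite ?eqxx.
Qed.

(** A divisor on the target lifts to one supported on any choice [c] of a single
    ray above each ray. *)
Lemma push_section (V : nmodType) (R S : finType) (pi : R -> S) (c : S -> R)
    (D : S -> V) :
  cancel c pi -> push pi (fun r => if r == c (pi r) then D (pi r) else 0) =1 D.
Proof.
move=> cK s; rewrite /push (bigD1 (c s)) ?cK //= eqxx big1 ?addr0 // => r.
by case/andP=> /eqP -> /negPf ->.
Qed.

Lemma push_int (K : pzRingType) (R S : finType) (pi : R -> S) (D : R -> int)
    (s : S) : push pi (fun r => (D r)%:~R : K) s = (push pi D s)%:~R.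
Proof. by rewrite /push rmorph_sum. Qed.

(** What the fans obtained by iterating [H(x,p)] have in common with respect to
    the original fan: [pi] sends a new ray to the ray it was split from, and
    [sec] selects one new ray above each old one.  Unlike the tower of the
    [Hfan], these properties do not refer to the order of the steps. *)
Record fan_lift (F G : fan) (pi : ray F -> ray G) (sec : ray G -> ray F) :
    Prop := FanLift {
  lift_secK : cancel sec pi;
  lift_pcoll : pcoll F = (fun P : {set ray G} => pi @^-1: P) @: pcoll G;
  lift_dim : (Defs.dim F + #|ray G| = Defs.dim G + #|ray F|)%N;
  lift_pic : forall (K : numDomainType) (D E : ray F -> K),
    pic_eq D E <-> pic_eq (push pi D) (push pi E)
}.

Lemma fan_lift_id (F : fan) : @fan_lift F F id id.
Proof.
have pushE (K : numDomainType) (D : ray F -> K) : D =1 push id D.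
  by move=> r; rewrite /push big_pred1_eq.
split=> // [|K D E].
  rewrite -[LHS]imset_id; apply: eq_imset => P.
  by apply/setP => r; rewrite !inE.
by split; apply: pic_eq_ext => r; rewrite -pushE.
Qed.

Lemma fan_lift_comp (F G H : fan) (pi : ray F -> ray G) (sec : ray G -> ray F)
    (pi' : ray G -> ray H) (sec' : ray H -> ray G) :
  fan_lift pi sec -> fan_lift pi' sec' -> fan_lift (pi' \o pi) (sec \o sec').
Proof.
move=> [secK pE dE picE] [secK' pE' dE' picE']; split.
- exact: can_comp.
- rewrite pE pE' -imset_comp; apply: eq_imset => P.
  by apply/setP => r; rewrite !inE.
- by lia.
- move=> K D E; rewrite picE picE'.
  by split; apply: pic_eq_ext => r; rewrite push_comp.
Qed.

Section HLift.
Variables (F : fan) (x : ray F) (p : nat).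

Definition H_proj (r : ray F + 'I_p.-1) : ray F :=
  if r is inl r0 then r0 else x.

Lemma push_H_proj (V : nmodType) (D : ray F + 'I_p.-1 -> V) (r : ray F) :
  push H_proj D r = D (inl r) + (if r == x then \sum_i D (inr i) else 0).
Proof.
rewrite /push big_sumType /= big_pred1_eq; congr (_ + _).
rewrite eq_sym; case: eqP => _; first by apply: eq_bigl.
by rewrite big_pred0.
Qed.

Lemma pairing_H_gen (K : numDomainType) (u : 'rV[K]_(Defs.dim F + p.-1))
    (r : ray F + 'I_p.-1) :
  pairing u (H_gen x r) =
    match r with
    | inl r0 => pairing (lsubmx u) (gen r0) -
        (if r0 == x then \sum_i u 0 (rshift _ i) else 0)
    | inr i => u 0 (rshift _ i)
    end.
Proof.
rewrite /pairing big_split_ord; case: r => [r0|i] /=.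
  congr (_ + _).
    by apply: eq_bigr => j _; rewrite row_mxEl mxE.
  case: eqP => _; last first.
    by rewrite oppr0 big1 // => j _; rewrite row_mxEr mxE mulr0.
  by rewrite -sumrN; apply: eq_bigr => j _; rewrite row_mxEr mxE mulrN1.
rewrite big1 ?add0r => [|j _]; last by rewrite row_mxEl mxE mulr0.
rewrite (bigD1 i) //= row_mxEr mxE !eqxx mulr1 big1 ?addr0 // => j ji.
by rewrite row_mxEr mxE (negPf ji) andbF mulr0.
Qed.

(** The last [p - 1] coordinates of a dual vector give arbitrary values on the
    rays [z_1, ..., z_(p-1)], and cancel from the sum over [z_1, ..., z_p];
    so only that sum matters for linear equivalence. *)
Lemma fan_lift_H : @fan_lift (Hfan x p) F H_proj inl.
Proof.
split=> // [||K D E].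
- apply: eq_imset => P; apply/setP => -[r|i]; rewrite !inE /H_set /=.
    have inlP : ((inl r : ray F + 'I_p.-1)%type \in inl @: P) = (r \in P).
      by apply: mem_imset => a b [].
    case: ifP => xP; rewrite ?inE inlP //.
    case: imsetP => [[i _ //]|_]; by rewrite orbF.
  have inrP : ((inr i : ray F + 'I_p.-1)%type \in inl @: P) = false.
    by apply/imsetP => -[].
  case: ifP => xP; rewrite ?inE inrP //=.
  by rewrite imset_f.
- by rewrite card_sum card_ord addnAC -addnA.
split=> [[u hu]|[u hu]].
  exists (lsubmx u) => r; rewrite !push_H_proj.
  have {}hu r' : D r' - E r' = pairing u (H_gen x r') := hu r'.
  have := hu (inl r); rewrite pairing_H_gen /=.
  case: eqP => [-> | _]; last by rewrite subr0 !addr0.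
  rewrite opprD addrACA => ->.
  rewrite -sumrB -[RHS](subrK (\sum_i u 0 (rshift _ i))); congr (_ + _).
  by apply: eq_bigr => i _; rewrite hu pairing_H_gen.
exists (row_mx u (\row_i (D (inr i) - E (inr i)))) => r.
rewrite [RHS]pairing_H_gen; case: r => [r|i] /=; last by rewrite row_mxEr mxE.
rewrite row_mxKl -hu !push_H_proj; case: eqP => [->|_]; last first.
  by rewrite subr0 !addr0.
under eq_bigr => i _ do rewrite row_mxEr mxE.
by rewrite sumrB opprD addrACA addrK.
Qed.
End HLift.

(** The multiplicities of the rays in [s] are recorded because the pushforward
    of the anticanonical divisor counts the rays of each fiber. *)
Lemma fan_lift_H2_seq (B : Type) (s : seq B) (F : fan) (lab : B -> ray F) :
  exists (pi : ray (H2_seq s lab) -> ray F) (sec : ray F -> ray (H2_seq s lab)),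
    fan_lift pi sec /\
    forall r, push pi (fun=> 1 : int) r = (count (fun b => lab b == r) s).+1%:R.
Proof.
elim: s F lab => [|a s IH] F lab /=.
  exists id, id; split; first exact: fan_lift_id.
  by move=> r; rewrite /push big_pred1_eq.
set lab' := fun b => inl (lab b) : ray (Hfan (lab a) 2).
have [pi [sec [liftF cnt]]] := IH _ lab'.
exists (@H_proj F (lab a) 2 \o pi), (sec \o inl).
split=> [|r]; first exact: fan_lift_comp (fan_lift_H _ _).
rewrite push_comp (push_ext _ cnt) push_H_proj.
have -> : count (fun b => lab' b == inl r) s = count (fun b => lab b == r) s.
  by apply: eq_count.
have c0 i : count (fun b => lab' b == inr i) s = 0%N.
  by rewrite (eq_count (a2 := pred0)) ?count_pred0.
rewrite big_ord1 c0 [lab a == r]eq_sym.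
by case: eqP => _; rewrite ?addr0 // -natrD addn1.
Qed.

(** * Nef classes under lifts *)

Section LiftNef.
Variables (F G : fan) (pi : ray F -> ray G) (sec : ray G -> ray F).
Hypothesis liftF : fan_lift pi sec.
Let secK : cancel sec pi := lift_secK liftF.

Definition push_div (E : divisor F) : divisor G := [ffun r => push pi E r].

Definition pull_div (E : divisor G) : divisor F :=
  [ffun r => if r == sec (pi r) then E (pi r) else 0].

Lemma pull_divK : cancel pull_div push_div.
Proof.
move=> E; apply/ffunP => r; rewrite ffunE -[RHS](push_section E secK).
by apply: push_ext => r'; rewrite ffunE.
Qed.

Lemma push_div_nonzero (E : divisor F) :
  pic_nonzero E <-> pic_nonzero (push_div E).
Proof.
have pE : pic_eq (E : _ -> int) (fun=> 0) <-> pic_eq (push_div E) (fun=> 0).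
  rewrite (lift_pic liftF); split; apply: pic_eq_ext => r; rewrite ?ffunE //;
  by rewrite /push big1.
by split=> nz /pE.
Qed.

(** A cone [A] of the lift determines the cone [A'] of those rays whose whole
    fiber lies in [A].  An effective representative below that misses [A'] lifts
    by placing each of its coefficients on a ray of the fiber outside [A]. *)
Lemma basepoint_free_lift (E : divisor F) :
  basepoint_free (push_div E) -> basepoint_free E.
Proof.
move=> bpfE A coneA.
pose A' := [set r | [forall r', (pi r' == r) ==> (r' \in A)]]%SET.
have [|D [ED D_ge0 DA]] := bpfE A'.
  apply/forall_inP => P PG; apply/negP => PA.
  have PF : (pi @^-1: P \in pcoll F)%SET.
    by rewrite (lift_pcoll liftF) imset_f.
  have /negP := forall_inP coneA _ PF; apply.
  apply/subsetP => r; rewrite inE => /(subsetP PA); rewrite inE.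
  by move/forallP/(_ r); rewrite eqxx.
pose c r := odflt (sec r) [pick r' | (pi r' == r) && (r' \notin A)].
have cK : cancel c pi.
  by move=> r; rewrite /c; case: pickP => [r' /andP[/eqP]|] //= _; exact: secK.
exists (fun r => if r == c (pi r) then D (pi r) else 0); split.
- apply/(lift_pic liftF); apply: pic_eq_ext ED => r; first by rewrite ffunE.
  by rewrite push_section.
- by move=> r; case: ifP.
- move=> r rA; case: eqP => // rc; apply: DA; rewrite inE.
  apply/forallP => r'; apply/implyP => /eqP r'r; move: rc; rewrite /c.
  case: pickP => [q /andP[_ qA] /= rq|/(_ r')].
    by rewrite rq (negPf qA) in rA.
  by rewrite r'r eqxx => /negPn.
Qed.

(** For an arbitrary dual vector [u] of the lift, the divisor of [u] pushes
    forward to a principal divisor, which vanishes on every relation of [G]. *)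
Lemma sum_lift (b : ray G -> int) :
  \sum_r b r *: gen r = 0 -> \sum_r b (pi r) *: gen r = 0.
Proof.
move=> rel; apply/rowP => j; rewrite mxE.
pose u : 'rV[int]_(Defs.dim F) := delta_mx 0 j.
have uE v : pairing u v = v 0 j.
  rewrite /pairing (bigD1 j) //= big1 => [|k kj].
    by rewrite mxE !eqxx mul1r addr0 intz.
  by rewrite mxE (negPf kj) andbF mul0r.
have [u' hu'] :
    pic_eq (push pi (fun r => pairing u (gen r))) (push pi (fun=> 0)).
  by apply/(lift_pic liftF); exists u => r; rewrite subr0.
rewrite -uE pairing_sum (partition_big pi predT) //=.
transitivity (pairing u' (\sum_r b r *: gen r)); last by rewrite rel pairing0.
rewrite pairing_sum; apply: eq_bigr => r _; rewrite -hu' /push.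
rewrite [X in _ - X]big1 // subr0 mulr_sumr.
by apply: eq_bigr => r' /eqP ->.
Qed.

(** A maximal set of rays whose full fibers are those over [A]; it spans a cone
    as soon as [A] does. *)
Definition lift_set (A : {set ray G}) : {set ray F} := ~: (sec @: (~: A)).

Lemma sec_lift_set (A : {set ray G}) (r : ray G) :
  (sec r \in lift_set A) = (r \in A).
Proof. by rewrite inE mem_imset ?inE ?negbK //; apply: can_inj secK. Qed.

Lemma spans_cone_lift (A : {set ray G}) :
  spans_cone A -> spans_cone (lift_set A).
Proof.
move=> coneA; apply/forall_inP => P'; rewrite (lift_pcoll liftF).
case/imsetP => P PG ->; apply/negP => PA.
have /negP := forall_inP coneA _ PG; apply; apply/subsetP => r rP.
by rewrite -sec_lift_set (subsetP PA) // inE secK.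
Qed.

Lemma lift_setU1 (A : {set ray G}) (r : ray G) : r \notin A ->
  sec r |: lift_set A = lift_set (r |: A).
Proof.
move=> rA; apply/setP => r'; rewrite !inE.
case: eqP => [->|r'r] /=.
  by rewrite mem_imset ?inE ?eqxx //; apply: can_inj secK.
congr (~~ _); apply/imsetP/imsetP => -[q qA r'q]; exists q => //.
  by move: qA; rewrite !inE negb_or => -> ; rewrite andbT; apply/eqP => qr;
    apply: r'r; rewrite r'q qr.
by move: qA; rewrite !inE negb_or => /andP[].
Qed.

(** The wall [W] with its two extra rays lifts to the wall [lift_set W] with
    the selected rays above them, and the lifted relation is constant on fibers,
    so both curves have the same degree. *)
Lemma nef_push (E : divisor F) : nef E -> nef (push_div E).
Proof.
move=> nefE W r1 r2 b [cW [r12 r1W r2W] W1 W2 rel].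
pose c := wall_coef W r1 r2 b.
have secI : injective sec := can_inj secK.
have lc : wall_coef (lift_set W) (sec r1) (sec r2) (c \o pi) =1 c \o pi.
  move=> r; rewrite /wall_coef; case: ifPn => //.
  rewrite inE negbK => /imsetP[q]; rewrite inE => qW ->.
  by rewrite /c /= secK /wall_coef (negPf qW) !(inj_eq secI).
have nr1 : sec r1 \notin lift_set W by rewrite sec_lift_set.
have nr2 : sec r2 \notin lift_set W by rewrite sec_lift_set.
have nr12 : sec r1 != sec r2 by rewrite (inj_eq secI).
have relF : wall_relation (lift_set W) (sec r1) (sec r2) (c \o pi).
  split=> //.
  - have := lift_dim liftF; rewrite -cW.
    have := cardsC (sec @: ~: W); have := cardsC W.
    by rewrite card_imset // /lift_set; lia.
  - by rewrite lift_setU1 //; exact: spans_cone_lift.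
  - by rewrite lift_setU1 //; exact: spans_cone_lift.
  - rewrite -sum_wall_coef //; under eq_bigr do rewrite lc.
    by apply: sum_lift; rewrite sum_wall_coef.
have := nefE _ _ _ _ relF; rewrite !curve_degreeE //.
under eq_bigr do rewrite lc.
rewrite (partition_big pi predT) //=; congr (0 <= _).
apply: eq_bigr => r _; rewrite ffunE /push mulr_sumr.
by apply: eq_bigr => r' /eqP ->.
Qed.

End LiftNef.
(** * Decompositions into nef classes *)

Section WeightsAndPush.
Variable K : realDomainType.

(** Decompositions have positive coefficients indexed by an ordinal; here zero
    weights and any finite index type are allowed, the zero weights being
    dropped. *)
Lemma nef_decomposition_of_weights (F : fan) (D : divisor F) (I : finType)
    (w : I -> K) (E : I -> divisor F) :
  (forall i, 0 <= w i) -> (forall i, nef (E i)) ->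
  (forall i, pic_nonzero (E i)) ->
  pic_eq (fun r => (D r)%:~R) (fun r => \sum_i w i * (E i r)%:~R) ->
  exists (k : nat) (a : 'I_k -> K) (E' : 'I_k -> divisor F),
    nef_decomposition D a E' /\ \sum_(i < k) a i = \sum_i w i.
Proof.
move=> w_ge0 nefE nzE DE.
have sum_pos (f : I -> K) : (forall i, w i = 0 -> f i = 0) ->
    \sum_(i in [pred i | 0 < w i]) f i = \sum_i f i.
  move=> f0; rewrite [RHS](bigID [pred i | 0 < w i]) /=.
  rewrite [X in _ + X]big1 ?addr0 // => i /negPf wi; apply: f0.
  by have := w_ge0 i; rewrite le_eqVlt wi orbF => /eqP.
exists #|[pred i | 0 < w i]|, (fun j => w (enum_val j)).
exists (fun j => E (enum_val j)).
split; last by rewrite -big_enum_val sum_pos.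
split=> // [j|]; first by have := enum_valP j.
apply: pic_eq_ext DE => // r.
rewrite -(big_enum_val (A := [pred i | 0 < w i]) (fun i => w i * (E i r)%:~R)).
by rewrite sum_pos // => i ->; rewrite mul0r.
Qed.

Section Lift.
Variables (F G : fan) (pi : ray F -> ray G) (sec : ray G -> ray F).
Hypothesis liftF : fan_lift pi sec.

Lemma pic_eq_sum_push (D : divisor F) (I : finType) (a : I -> K)
    (E : I -> divisor F) :
  pic_eq (fun r => (D r)%:~R) (fun r => \sum_i a i * (E i r)%:~R) <->
  pic_eq (fun r => (push_div pi D r)%:~R)
         (fun r => \sum_i a i * (push_div pi (E i) r)%:~R).
Proof.
rewrite (lift_pic liftF); split; apply: pic_eq_ext => r;
  rewrite ?ffunE ?push_int //.
all: rewrite /push exchange_big; apply: eq_bigr => i _.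
all: by rewrite ffunE /push rmorph_sum mulr_sumr.
Qed.

Lemma nef_decomposition_push (D : divisor F) (k : nat) (a : 'I_k -> K)
    (E : 'I_k -> divisor F) :
  nef_decomposition D a E ->
  nef_decomposition (push_div pi D) a (fun i => push_div pi (E i)).
Proof.
case=> a_gt0 nefE nzE DE; split=> // [i|i|].
- exact: nef_push liftF _ (nefE i).
- exact/(push_div_nonzero liftF).
- exact/pic_eq_sum_push.
Qed.
End Lift.
End WeightsAndPush.

(** * The nef cone of Y *)

Lemma exists_card_between (T : finType) (A B : {set T}) (k : nat) :
  A \subset B -> (#|A| <= k <= #|B|)%N ->
  exists C : {set T}, [/\ A \subset C, C \subset B & #|C| = k].
Proof.
move=> AB /andP[]; elim: k => [|k IH] Ak kB.
  by exists A; split=> //; apply/eqP; rewrite -leqn0.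
move: Ak; rewrite leq_eqVlt => /predU1P[Ak|Ak]; first by exists A.
have [C [AC CB cC]] := IH Ak (ltnW kB).
have /set0Pn[x] : B :\: C != set0.
  apply: contraTneq kB => /eqP; rewrite setD_eq0 => /subset_leq_card.
  by rewrite cC -leqNgt.
rewrite inE => /andP[xC xB]; exists (x |: C).
rewrite subUset sub1set xB CB cardsU1 xC cC; split=> //.
exact: subset_trans AC (subsetUr _ _).
Qed.

Lemma sum_indicator (T : finType) (A : {set T}) :
  \sum_i (i \in A)%:R = #|A|%:R :> int.
Proof.
by rewrite -sumr_const [RHS]big_mkcond; apply: eq_bigr => i _; case: ifP.
Qed.

Section YFan.
Variables m n : nat.
Hypothesis n_le : (n <= m.*2.+2)%N.

Notation Yray := (ray (Yfan m n)).
Notation xi := (@x_idx m n).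

Lemma x_idxE (i : 'I_n) : xi i = i :> nat.
Proof. by rewrite inordK // (leq_trans (ltn_ord i)). Qed.

Lemma x_idx_inj : injective (@x_idx m n).
Proof. by move=> i j /(congr1 val) /=; rewrite !x_idxE => /val_inj. Qed.

Definition x_deg (K : nmodType) (D : Y_ray m n -> K) : K := \sum_i D (inl i).

Definition pair_deg (K : nmodType) (D : Y_ray m n -> K) (i : 'I_n) : K :=
  D (x_ray m i) + D (y_ray m i).

Lemma sum_x_vec : \sum_(k < m.*2.+2) x_vec m k = 0.
Proof.
apply/rowP => j; rewrite big_ord_recr /= mxE [in X in X + _]summxE !mxE ltnn.
rewrite (bigD1 j) //= big1 => [|k kj].
  by rewrite mxE /= ltn_ord eqxx addr0 subrr.
rewrite mxE /= ltn_ord; case: eqP => // e.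
by case/eqP: kj; apply: val_inj.
Qed.

(** The only relations among the rays of [Y] are [sum_i x_i = 0] and
    [x_i + y_i = 0], so these relations detect the classes of divisors. *)
Lemma Y_pic_eqP (K : numDomainType) (D E : Yray -> K) :
  pic_eq D E <-> x_deg D = x_deg E /\ pair_deg D =1 pair_deg E.
Proof.
split=> [[u hu]|[eqx eqf]].
  have {}hu r : D r - E r = pairing u (Y_gen r) := hu r.
  split=> [|i]; apply/eqP; rewrite -subr_eq0.
    rewrite -sumrB; apply/eqP.
    transitivity (pairing u (\sum_(k < m.*2.+2) 1 *: x_vec m k)).
      by rewrite pairing_sum; apply: eq_bigr => k _; rewrite hu mul1r.
    by under eq_bigr do rewrite scale1r; rewrite sum_x_vec pairing0.
  by rewrite opprD addrACA !hu /= x_idxE pairingN subrr.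
pose w j := widen_ord (leqnSn m.*2.+1) j.
pose u := \row_j (D (inl (w j)) - E (inl (w j))).
have xP (i : 'I_m.*2.+2) : D (inl i) - E (inl i) = pairing u (x_vec m i).
  case: (ltnP i m.*2.+1) => [lti|gei].
    have -> : i = w (Ordinal lti) by apply: val_inj.
    rewrite /pairing (bigD1 (Ordinal lti)) //= big1 => [|j jlt].
      by rewrite !mxE /= lti eqxx mulr1 addr0.
    rewrite !mxE /= lti; case: eqP => [e|]; last by rewrite mulr0.
    by case/eqP: jlt; apply: val_inj.
  have -> : i = ord_max.
    by apply: val_inj; apply/eqP; rewrite eqn_leq gei -ltnS ltn_ord.
  have := eqx; rewrite /x_deg big_ord_recr [RHS]big_ord_recr /= => /eqP.
  rewrite -subr_eq0 opprD addrACA -sumrB addr_eq0 => /eqP e.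
  rewrite -[LHS]opprK -e -sumrN; apply: eq_bigr => j _.
  by rewrite !mxE ltnn mulrN1.
exists u => -[i|i]; first exact: xP.
have /eqP := eqf i.
rewrite -subr_eq0 opprD addrACA xP addrC addr_eq0 => /eqP ->.
by rewrite /= x_idxE pairingN.
Qed.

Definition Yset (A : {set 'I_m.*2.+2}) (B : {set 'I_n}) : {set Yray} :=
  [set r : Y_ray m n | match r with inl i => i \in A | inr j => j \in B end].

Lemma sum_Yset (V : nmodType) (A : {set 'I_m.*2.+2}) (B : {set 'I_n})
    (f : Yray -> V) :
  \sum_(r in Yset A B) f r = \sum_(i in A) f (inl i) + \sum_(j in B) f (inr j).
Proof.
by rewrite big_sumType /=; congr (_ + _); apply: eq_bigl => i; rewrite inE.
Qed.

Lemma card_Yset (A : {set 'I_m.*2.+2}) (B : {set 'I_n}) :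
  #|Yset A B| = (#|A| + #|B|)%N.
Proof.
by rewrite -!sum1_card big_sumType /=; congr (_ + _)%N; apply: eq_bigl => i;
  rewrite inE.
Qed.

Lemma setU1_Yset_x (A : {set 'I_m.*2.+2}) (B : {set 'I_n}) i :
  (inl i : Yray) |: Yset A B = Yset (i |: A) B.
Proof. by apply/setP => -[j|j]; rewrite !inE. Qed.

Lemma setU1_Yset_y (A : {set 'I_m.*2.+2}) (B : {set 'I_n}) i :
  (inr i : Yray) |: Yset A B = Yset A (i |: B).
Proof. by apply/setP => -[j|j]; rewrite !inE. Qed.

Lemma sum_x_idx (V : nmodType) (I : {set 'I_n}) (f : 'I_m.*2.+2 -> V) :
  \sum_(i in ~: (xi @: I)) f i + \sum_(i in I) f (xi i) = \sum_i f i.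
Proof.
rewrite -(big_imset f (in2W x_idx_inj)) /=.
rewrite [RHS](bigID (mem (xi @: I))) /= addrC; congr (_ + _).
by apply: eq_bigl => i; rewrite inE.
Qed.

(** The three families of primitive collections, as conditions on the two parts
    of a set of rays. *)
Lemma spans_cone_YP (A : {set Yray}) :
  reflect
    [/\ forall i, x_ray m i \in A -> y_ray m i \notin A,
        forall I : {set 'I_n}, #|I| = m ->
          ~ {subset ~: (xi @: I) <= [pred j | inl j \in A]}
      & forall J : {set 'I_n}, #|J| = m.+1 ->
          ~ {subset J <= [pred j | inr j \in A]}]
    (spans_cone A).
Proof.
apply: (iffP forall_inP) => [cone|[no_xy no_x no_y] P].
  have conP P : P \in Y_pcoll m n -> ~ P \subset A.
    by move=> PY; apply/negP; exact: cone.
  split.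
  - move=> i xA; apply/negP => yA; apply: (conP [set x_ray m i; y_ray m i]).
      by rewrite !in_setU; apply/orP; left; apply/orP; left; apply: imset_f.
    by rewrite subUset !sub1set xA.
  - move=> I cI sub; apply: (conP (inl @: (~: (xi @: I)))).
      rewrite !in_setU; apply/orP; left; apply/orP; right.
      by apply/imsetP; exists I; rewrite // inE cI.
    by apply/subsetP => _ /imsetP[j jI ->]; exact: sub.
  - move=> J cJ sub; apply: (conP (@y_ray m n @: J)).
      rewrite !in_setU; apply/orP; right.
      by apply/imsetP; exists J; rewrite // inE cJ.
    by apply/subsetP => _ /imsetP[j jJ ->]; exact: sub.
rewrite !in_setU => /orP[/orP[]|] /imsetP[I hI ->]; apply/negP => /subsetP sub.
- have xA : x_ray m I \in A by apply: sub; rewrite !inE eqxx.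
  by have := no_xy _ xA; rewrite sub // !inE eqxx orbT.
- apply: (no_x I) => [|j jI]; first by move: hI; rewrite inE => /eqP.
  by apply: sub; apply: imset_f.
- apply: (no_y I) => [|j jI]; first by move: hI; rewrite inE => /eqP.
  by apply: sub; apply: imset_f.
Qed.

Lemma card_setC_x_idx (I : {set 'I_n}) : #|~: (xi @: I)| = (m.*2.+2 - #|I|)%N.
Proof.
by rewrite cardsCs setCK card_ord (card_imset _ x_idx_inj).
Qed.

Lemma spans_cone_Yset (A : {set 'I_m.*2.+2}) (B : {set 'I_n}) :
  (forall i, i \in B -> xi i \notin A) -> (#|A| <= m.+1)%N ->
  (#|B| <= m)%N -> spans_cone (Yset A B).
Proof.
move=> dis cA cB; apply/spans_cone_YP; split=> [i|I cI|J cJ].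
- by rewrite !inE => iA; apply: contraL iA; exact: dis.
- move=> sub; have : (#|~: (xi @: I)| <= #|A|)%N.
    by apply: subset_leq_card; apply/subsetP => j /sub; rewrite !inE.
  by rewrite card_setC_x_idx cI; lia.
- move=> sub; have : (#|J| <= #|B|)%N.
    by apply: subset_leq_card; apply/subsetP => j /sub; rewrite !inE.
  by rewrite cJ; lia.
Qed.

(** The wall of the primitive relation
    [sum_(i notin I) x_i = sum_(i in I) y_i]: two of the [x_i] on the left are
    the outer rays, and the wall consists of all other rays of the relation. *)
Lemma nef_x_deg_ge (D : divisor (Yfan m n)) (I : {set 'I_n}) :
  nef D -> #|I| = m -> \sum_(i in I) pair_deg D i <= x_deg D.
Proof.
move=> nefD cI; set X := ~: (xi @: I).
have cX : #|X| = m.+2.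
  by rewrite card_setC_x_idx cI; lia.
have /card_gt1P[a [b [aX bX ab]]] : (1 < #|X|)%N by rewrite cX.
have bXa : b \in X :\ a by rewrite in_setD1 eq_sym ab.
have XC : X :\ a :\ b = X :\ b :\ a by rewrite !setDDl setUC.
pose W := Yset (X :\ a :\ b) I.
pose c (r : Yray) : int := if r is inl _ then 1 else -1.
have sumE (V : lmodType int) (f : Yray -> V) :
    f (inl a) + f (inl b) + \sum_(r in W) c r *: f r =
    \sum_(i in X) f (inl i) - \sum_(i in I) f (inr i).
  rewrite sum_Yset (big_setD1 a aX) (big_setD1 b bXa) /=.
  rewrite -!addrA; congr (_ + (_ + (_ + _))).
    by apply: eq_bigr => i _; rewrite scale1r.
  by rewrite -sumrN; apply: eq_bigr => i _; rewrite scaleN1r.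
have cXab : #|X :\ a :\ b| = m.
  by move: cX; rewrite (cardsD1 a) aX (cardsD1 b) bXa; lia.
have disX i : i \in I -> xi i \notin X.
  by move=> iI; rewrite inE negbK imset_f.
have wall : @wall_relation (Yfan m n) W (inl a) (inl b) c.
  split=> //.
  - by rewrite card_Yset cXab cI addnn.
  - by rewrite !inE !eqxx ?andbF; split.
  - rewrite setU1_Yset_x XC setD1K; last by rewrite in_setD1 ab.
    apply: spans_cone_Yset => [i /disX|//|]; last by rewrite cI.
      by apply: contra => /setD1P[].
    by rewrite -ltnS -cX (cardsD1 b) bX.
  - rewrite setU1_Yset_x setD1K //.
    apply: spans_cone_Yset => [i /disX|//|]; last by rewrite cI.
      by apply: contra => /setD1P[].
    by rewrite -ltnS -cX (cardsD1 a) aX.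
  - rewrite sumE -sumrN /= -[RHS]sum_x_vec -(sum_x_idx I); congr (_ + _).
    by apply: eq_bigr => i _; rewrite opprK x_idxE.
have := nefD _ _ _ _ wall; rewrite /curve_degree.
have /= -> := @sumE int^o D.
rewrite /x_deg -(sum_x_idx I) /pair_deg big_split /=; lra.
Qed.

(** The wall of the primitive relation
    [sum_(j in J) y_j = sum_(j notin J) x_j], the outer rays being two of the
    [y_j]; this is where [m > 0] gives at least two of them. *)
Lemma nef_x_deg_le (D : divisor (Yfan m n)) (J : {set 'I_n}) :
  (0 < m)%N -> nef D -> #|J| = m.+1 -> x_deg D <= \sum_(j in J) pair_deg D j.
Proof.
move=> m_gt0 nefD cJ; set X := ~: (xi @: J).
have cX : #|X| = m.+1 by rewrite card_setC_x_idx cJ; lia.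
have /card_gt1P[a [b [aJ bJ ab]]] : (1 < #|J|)%N by rewrite cJ ltnS.
have bJa : b \in J :\ a by rewrite in_setD1 eq_sym ab.
have JC : J :\ a :\ b = J :\ b :\ a by rewrite !setDDl setUC.
pose W := Yset X (J :\ a :\ b).
pose c (r : Yray) : int := if r is inl _ then -1 else 1.
have sumE (V : lmodType int) (f : Yray -> V) :
    f (inr a) + f (inr b) + \sum_(r in W) c r *: f r =
    \sum_(j in J) f (inr j) - \sum_(i in X) f (inl i).
  rewrite sum_Yset (big_setD1 a aJ) (big_setD1 b bJa) /= [LHS]addrCA addrC.
  rewrite -!addrA; congr (_ + (_ + (_ + _))).
    by apply: eq_bigr => i _; rewrite scale1r.
  by rewrite -sumrN; apply: eq_bigr => i _; rewrite scaleN1r.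
have cJab : #|J :\ a :\ b|.+1 = m.
  by move: cJ; rewrite (cardsD1 a) aJ (cardsD1 b) bJa => -[].
have disX i : i \in J -> xi i \notin X.
  by move=> iJ; rewrite inE negbK imset_f.
have wall : @wall_relation (Yfan m n) W (inr a) (inr b) c.
  split=> //.
  - by rewrite card_Yset cX addSnnS cJab addnn.
  - by rewrite !inE !eqxx ?andbF; split.
  - rewrite setU1_Yset_y JC setD1K; last by rewrite in_setD1 ab.
    apply: spans_cone_Yset => [i /setD1P[_ /disX] //|//|]; first by rewrite cX.
    by rewrite -ltnS -cJ (cardsD1 b J) bJ.
  - rewrite setU1_Yset_y setD1K //.
    apply: spans_cone_Yset => [i /setD1P[_ /disX] //|//|]; first by rewrite cX.
    by rewrite -ltnS -cJ (cardsD1 a J) aJ.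
  - rewrite sumE /= -[RHS]oppr0 -[in RHS]sum_x_vec -(sum_x_idx J) opprD addrC.
    by congr (_ + _); rewrite -sumrN; apply: eq_bigr => i _; rewrite x_idxE.
have := nefD _ _ _ _ wall; rewrite /curve_degree.
have /= -> := @sumE int^o D.
rewrite /x_deg -(sum_x_idx J) /pair_deg big_split /=; lra.
Qed.

Lemma exists_card_disjoint (A : {set 'I_n}) (k : nat) :
  (k + #|A| <= n)%N -> exists C : {set 'I_n}, [disjoint C & A] /\ #|C| = k.
Proof.
move=> kA; have bnd : (#|set0 : {set 'I_n}| <= k <= #|~: A|)%N.
  by rewrite cards0 cardsCs setCK card_ord; lia.
have [C [_ CA cC]] := exists_card_between (sub0set _) bnd.
by exists C; rewrite disjoints_subset.
Qed.

(** Comparing [s >= sum_I t] with [s <= sum_J t] for [J = j |: I] gives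
    [t_j >= 0].  If [t_k = t_i = 0], comparing [s <= sum_({k, i} + I) t] with
    [s >= sum_({j} + I) t] for [#|I| = m - 1] gives [t_j <= 0] for all other
    [j], and the class is zero; [n >= m + 2] leaves room for [I]. *)
Lemma nef_pair_deg_ge1 (D : divisor (Yfan m n)) :
  (0 < m)%N -> (m + 2 <= n)%N -> nef D -> pic_nonzero D ->
  exists k : 'I_n, forall i, i != k -> 1 <= pair_deg D i.
Proof.
move=> m_gt0 mn nefD D_nz; set t := pair_deg D.
have ge := nef_x_deg_ge nefD; have le := nef_x_deg_le m_gt0 nefD.
have sumU1 i (A : {set 'I_n}) : i \notin A ->
    \sum_(j in i |: A) t j = t i + \sum_(j in A) t j by exact: big_setU1.
have t_ge0 j : 0 <= t j.
  have [|I [dI cI]] := @exists_card_disjoint [set j] m.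
    by rewrite cards1; lia.
  have jI : j \notin I by rewrite (disjointFl dI) // inE.
  have := ge _ cI; have := le (j |: I).
  rewrite cardsU1 jI cI sumU1 // -/t => /(_ erefl); lra.
have [/forallP t_ge1|] := boolP [forall i, 1 <= t i].
  by exists (Ordinal (leq_trans (ltnW (ltn_addl m (ltnSn 1))) mn)).
case/forallPn => k t_lt1; exists k => i ik; rewrite -/(t i).
have tk : t k = 0 by have := t_ge0 k; lia.
rewrite leNgt; apply/negP => ti_lt1.
have ti : t i = 0 by have := t_ge0 i; lia.
have t0 j : t j = 0.
  have [->//|jk] := eqVneq j k; have [->//|ji] := eqVneq j i.
  have [|I [dI cI]] := @exists_card_disjoint [set i; j; k] m.-1.
    apply: leq_trans (leq_add (leqnn _) (leq_card_setU _ _)) _.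
    by rewrite cards2 cards1; case: (i != j) => /=; lia.
  have [iI jI kI] : [/\ i \notin I, j \notin I & k \notin I].
    by split; rewrite (disjointFl dI) // !inE eqxx ?orbT.
  have kiI : k \notin i |: I by rewrite !inE eq_sym (negPf ik).
  have := ge (j |: I); have := le (k |: (i |: I)).
  rewrite !cardsU1 jI iI kiI cI !sumU1 // -/t tk ti !add1n prednK //.
  by move=> /(_ erefl) ? /(_ erefl) ?; have := t_ge0 j; lra.
have [|I [_ cI]] := @exists_card_disjoint set0 m; first by rewrite cards0; lia.
have [|J [_ cJ]] := @exists_card_disjoint set0 m.+1.
  by rewrite cards0; lia.
apply: D_nz; apply/Y_pic_eqP; split=> [|j]; last first.
  by rewrite -/(t j) t0 /pair_deg addr0.
have := ge _ cI; have := le _ cJ; rewrite -/t !big1 // => s0 s1.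
by rewrite [RHS]big1 //; lra.
Qed.

Lemma nef_x_deg_ge_m (D : divisor (Yfan m n)) :
  (0 < m)%N -> (m + 2 <= n)%N -> nef D -> pic_nonzero D -> m%:R <= x_deg D.
Proof.
move=> m_gt0 mn nefD D_nz.
have [k t_ge1] := nef_pair_deg_ge1 m_gt0 mn nefD D_nz.
have [|I [dI cI]] := @exists_card_disjoint [set k] m.
  by rewrite cards1; lia.
apply: le_trans (nef_x_deg_ge nefD cI).
rewrite -[X in X%:R <= _]cI -sumr_const; apply: ler_sum => i iI; apply: t_ge1.
by apply: contraTneq iI => ->; rewrite (disjointFl dI) // inE.
Qed.

Lemma nef_sum_pair_deg_ge (D : divisor (Yfan m n)) :
  (0 < m)%N -> (m + 2 <= n)%N -> nef D -> pic_nonzero D ->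
  (n - m.+1)%:R <= \sum_i pair_deg D i - x_deg D.
Proof.
move=> m_gt0 mn nefD D_nz.
have [k t_ge1] := nef_pair_deg_ge1 m_gt0 mn nefD D_nz.
have bnd : (#|[set k]| <= m.+1 <= #|[set: 'I_n]|)%N.
  by rewrite cards1 cardsT card_ord; lia.
have [J [kJ _ cJ]] := exists_card_between (subsetT _) bnd.
rewrite lerBrDr (le_trans (lerD (lexx _) (nef_x_deg_le m_gt0 nefD cJ))) //.
rewrite [leRHS](bigID (mem J)) /= [leRHS]addrC lerD2r.
have -> : (n - m.+1)%N = #|~: J| by rewrite cardsCs setCK card_ord cJ.
rewrite -sumr_const [leLHS](eq_bigl (fun i => i \notin J)) => [|i]; last first.
  by rewrite inE.
apply: ler_sum => i iJ; apply: t_ge1; apply: contraNneq iJ => ->.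
by rewrite -sub1set.
Qed.
End YFan.

(** * Base-point-free classes on Y *)

Section Classes.
Variables m n : nat.
Hypothesis n_le : (n <= m.*2.+2)%N.
Notation Yray := (ray (Yfan m n)).
Notation xi := (@x_idx m n).

(** Changing [al] without changing its sum gives a linearly equivalent divisor:
    the effective representatives of a class are found among these. *)
Definition Ydiv (al : 'I_m.*2.+2 -> int) (U : {set 'I_n}) :
    divisor (Yfan m n) :=
  [ffun r : Y_ray m n => match r with
    | inl i => al i
    | inr j => (j \in U)%:R - al (xi j)
    end].

Lemma x_deg_Ydiv al U : x_deg (Ydiv al U) = \sum_i al i.
Proof. by apply: eq_bigr => i _; rewrite ffunE. Qed.

Lemma pair_deg_Ydiv al U i : pair_deg (Ydiv al U) i = (i \in U)%:R.
Proof. by rewrite /pair_deg !ffunE addrC subrK. Qed.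

(** For a cone [A] the representative must have coefficients [al' >= 0] of sum
    [c] with [al' (x_i) <= 1] for [i] in [U] and [al' (x_i) = 0] for other
    [i < n], vanishing on the [x_i] in [A] and saturating the bound when [y_i]
    is in [A].  It is the indicator of some [B], plus [g] carried by an [x_j]
    with [j >= n].  If such an [x_j] lies outside [A], it absorbs what is left
    of [c]; otherwise, as [A] is a cone, more than [m] of the [x_i] lie outside
    [A], which leaves room for [B] to have [c] elements. *)
Lemma basepoint_free_Ydiv al (U : {set 'I_n}) (c : nat) :
  \sum_i al i = c%:R -> (m <= c)%N -> (c + #|~: U| <= m.+1)%N -> (m <= n)%N ->
  basepoint_free (Ydiv al U).
Proof.
move=> sum_al mc cU mn A /spans_cone_YP[// no_xy no_x no_y].
pose AY := [set j | inr j \in A] : {set 'I_n}.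
pose Q := [set i | inl (xi i) \notin A] : {set 'I_n}.
have cAY : (#|AY| <= m)%N.
  rewrite leqNgt; apply/negP => ltm.
  have bnd : (#|set0 : {set 'I_n}| <= m.+1 <= #|AY|)%N by rewrite cards0.
  have [J [_ /subsetP JA cJ]] := exists_card_between (sub0set _) bnd.
  by apply: (no_y _ cJ) => j /JA; rewrite inE.
have AYQ : AY \subset Q.
  by apply/subsetP => j; rewrite !inE; apply: contraL; exact: no_xy.
have [B [g [AB BQ BgE g_ge0 [gx gA]]]] :
    exists (B : {set 'I_n}) (g : 'I_m.*2.+2 -> int),
    [/\ AY :&: U \subset B, B \subset Q :&: U, #|B|%:R + \sum_i g i = c%:R,
        forall i, 0 <= g i & (forall j, g (xi j) = 0) /\
        (forall i, inl i \in A -> g i = 0)].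
  (* Is some [x_j] with [j >= n] outside [A]? *)
  have [/existsP[j /andP[jA jx]]|none] :=
      boolP [exists j : 'I_m.*2.+2, (inl j \notin A) && (j \notin xi @: setT)].
    have cB : (#|AY :&: U| <= c)%N.
      apply: leq_trans (subset_leq_card (subsetIl _ _)) _.
      exact: leq_trans cAY mc.
    exists (AY :&: U), (fun i => if i == j then (c - #|AY :&: U|)%:R else 0).
    split; [by []|exact: setSI| | |split].
    - by rewrite -big_mkcond big_pred1_eq -natrD subnKC.
    - by move=> i; case: ifP => // _; exact: ler0n.
    - by move=> i; case: eqP => // ij; rewrite -ij imset_f ?inE in jx.
    - by move=> i iA; case: eqP => // ij; rewrite -ij iA in jA.
  have cQ : (m < #|Q|)%N.
    rewrite ltnNge; apply/negP => Qm.
    have bnd : (#|Q| <= m <= #|[set: 'I_n]|)%N by rewrite Qm cardsT card_ord.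
    have [I [/subsetP QI _ cI]] := exists_card_between (subsetT _) bnd.
    apply: (no_x _ cI) => j; rewrite !inE => jI.
    apply: contraNT none => jA; apply/existsP; exists j; rewrite jA /=.
    apply: contra jI => /imsetP[i _ ji]; rewrite ji; apply: imset_f.
    by apply: QI; rewrite inE -ji.
  have bnd : (#|AY :&: U| <= c <= #|Q :&: U|)%N.
    rewrite (leq_trans (leq_trans (subset_leq_card (subsetIl _ _)) cAY)) //=.
    rewrite -(leq_add2r #|~: U|) (leq_trans cU) // (leq_trans cQ) //.
    by rewrite -(cardsID U Q) leq_add2l subset_leq_card // setDE subsetIr.
  have [B [AB BQ cB]] := exists_card_between (setSI U AYQ) bnd.
  by exists B, (fun=> 0); split=> //; rewrite cB big1 ?addr0.
have xiI := x_idx_inj n_le.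
pose al' i := (i \in xi @: B)%:R + g i.
have al'x j : al' (xi j) = (j \in B)%:R.
  by rewrite /al' gx addr0 mem_imset.
exists (Ydiv al' U); split.
- apply/(Y_pic_eqP n_le); split=> [|i]; last by rewrite !pair_deg_Ydiv.
  by rewrite !x_deg_Ydiv sum_al big_split /= sum_indicator card_imset // -BgE.
- move=> -[i|j]; rewrite ffunE; first by rewrite addr_ge0 ?ler0n.
  rewrite al'x; case: (boolP (j \in B)) => [/(subsetP BQ)|_].
    by rewrite inE => /andP[_ ->].
  by rewrite subr0 ler0n.
- move=> -[i|j] rA; rewrite ffunE.
    rewrite /al' gA // addr0; case: imsetP => // -[j /(subsetP BQ)].
    by rewrite !inE => /andP[jA _] ij; rewrite -ij rA in jA.
  rewrite al'x; have [jU|jU] := boolP (j \in U).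
    by rewrite (subsetP AB) ?subrr // !inE rA.
  case: (boolP (j \in B)) => [/(subsetP BQ)|//].
  by rewrite inE (negPf jU) andbF.
Qed.
End Classes.

(** * The best decompositions on Y *)

(** The number [q] such that the total weights [W >= 3] of the decompositions
    of the anticanonical class are those with [q (W - 3) <= 1]. *)
Definition tau_denom (m n : nat) := maxn m (n - m.+1).

Section Decompositions.
Variable K : realDomainType.

Section OnY.
Variables m n : nat.
Hypotheses (m_gt0 : (0 < m)%N) (mn : (m + 2 <= n)%N) (n_le : (n <= m.*2.+2)%N).

Lemma x_deg_sum (I : finType) (a : I -> K) (E : I -> divisor (Yfan m n)) :
  x_deg (fun r => \sum_i a i * (E i r)%:~R) = \sum_i a i * (x_deg (E i))%:~R.
Proof.
rewrite /x_deg exchange_big; apply: eq_bigr => i _.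
by rewrite rmorph_sum mulr_sumr.
Qed.

Lemma pair_deg_sum (I : finType) (a : I -> K) (E : I -> divisor (Yfan m n)) j :
  pair_deg (fun r => \sum_i a i * (E i r)%:~R) j =
  \sum_i a i * (pair_deg (E i) j)%:~R.
Proof.
by rewrite /pair_deg -big_split; apply: eq_bigr => i _; rewrite rmorphD mulrDr.
Qed.

Lemma x_deg_int (D : divisor (Yfan m n)) :
  x_deg (fun r => (D r)%:~R : K) = (x_deg D)%:~R.
Proof. by rewrite [RHS]rmorph_sum. Qed.

Lemma pair_deg_int (D : divisor (Yfan m n)) j :
  pair_deg (fun r => (D r)%:~R : K) j = (pair_deg D j)%:~R.
Proof. by rewrite [RHS]rmorphD. Qed.

Lemma sum_pos_ord (k : nat) : \sum_(i < k) (0 < i)%N%:R = (k.-1)%:R :> K.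
Proof.
case: k => [|k]; first by rewrite big_ord0.
by rewrite big_ord_recl add0r /= sumr_const card_ord.
Qed.

Variable D : divisor (Yfan m n).
Hypotheses (x_degD : x_deg D = (3 * m + 1)%:R)
  (pair_degD : forall i, pair_deg D i = (2 + (0 < i))%N%:R).

(** Each summand contributes at least [m] to [s] and at least [n - m - 1] to
    [sum_i t_i - s], whose values on [D] are [3m + 1] and
    [3 (n - m - 1) + 1]. *)
Lemma weight_le (k : nat) (a : 'I_k -> K) (E : 'I_k -> divisor (Yfan m n)) :
  nef_decomposition D a E -> (tau_denom m n)%:R * (\sum_(i < k) a i - 3) <= 1.
Proof.
case=> a_gt0 nefE nzE /(Y_pic_eqP n_le)[]; rewrite x_deg_sum => eqx eqf.
have boundm : m%:R * \sum_(i < k) a i <= (3 * m + 1)%:R.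
  have -> : (3 * m + 1)%:R = x_deg (fun r => (D r)%:~R) :> K.
    by rewrite x_deg_int x_degD mulrz_nat.
  rewrite eqx mulr_sumr; apply: ler_sum => i _.
  rewrite mulrC ler_pM2l // -[m%:R]mulrz_nat ler_int.
  exact: nef_x_deg_ge_m.
have boundn : (n - m.+1)%:R * \sum_(i < k) a i <= (3 * (n - m.+1) + 1)%:R.
  have -> : (3 * (n - m.+1) + 1)%:R = \sum_j pair_deg (fun r => (D r)%:~R) j -
     x_deg (fun r => (D r)%:~R) :> K.
    under eq_bigr do rewrite pair_deg_int pair_degD mulrz_nat natrD.
    rewrite big_split /= sum_pos_ord sumr_const card_ord.
    rewrite x_deg_int x_degD mulrz_nat.
    rewrite -mulrnA -natrD -natrB; last by lia.
    by congr (_%:R); lia.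
  rewrite eqx (eq_bigr _ (fun j _ => eqf j)).
  under eq_bigr do rewrite pair_deg_sum.
  rewrite exchange_big -sumrB mulr_sumr; apply: ler_sum => i _.
  rewrite -mulr_sumr -mulrBr -rmorph_sum -rmorphB /= mulrC ler_pM2l //.
  rewrite -[(n - m.+1)%:R]mulrz_nat ler_int.
  exact: nef_sum_pair_deg_ge.
rewrite /tau_denom mulrBr lerBlDr -natrM -[1]/(1%:R) -natrD addnC mulnC.
by case: leqP.
Qed.

(** The index [inl k] stands for [e_k], and [inr b] for [f_(m+b)].  With total
    weight [W], the [j]-th entry [t_j = 2 + (0 < j)] forces the weight
    [W - t_j] on [e_j], the value [s = 3m + 1] forces the weight of
    [f_(m+1)], and the rest goes to [f_m]; nonnegativity is the hypothesis on
    [W]. *)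
Lemma exists_nef_decomposition (W : K) :
  3 <= W -> (tau_denom m n)%:R * (W - 3) <= 1 ->
  exists (w : 'I_n + bool -> K) (E : 'I_n + bool -> divisor (Yfan m n)),
  [/\ forall i, 0 <= w i, forall i, basepoint_free (E i),
      forall i, pic_nonzero (E i), \sum_i w i = W &
      pic_eq (fun r => (D r)%:~R) (fun r => \sum_i w i * (E i r)%:~R)].
Proof.
move=> W3 denomW.
pose al (c : nat) (i : 'I_m.*2.+2) : int := if i == ord0 then c%:R else 0.
have sum_al c : \sum_i al c i = c%:R by rewrite -big_mkcond big_pred1_eq.
pose E (i : 'I_n + bool) : divisor (Yfan m n) := match i with
  | inl k => Ydiv (al m) (~: [set k])
  | inr b => Ydiv (al (m + b)%N) setT
  end.
pose w (i : 'I_n + bool) : K := match i with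
  | inl k => W - 2 - (0 < k)%N%:R
  | inr true => 1 - m%:R * (W - 3)
  | inr false => 1 - (n - m.+1)%:R * (W - 3)
  end.
have xE i : x_deg (E i) = (if i is inr true then m.+1 else m)%:R.
  by case: i => [k|[]] /=; rewrite x_deg_Ydiv sum_al ?addn1 ?addn0.
have sumw : \sum_i w i = W.
  rewrite big_sumType /= !sumrB !sumr_const card_ord sum_pos_ord.
  rewrite big_bool /= natrB; last by lia.
  have -> : n = n.-1.+1 by lia.
  rewrite /= -![W *+ _]mulr_natr -![2 *+ _]mulr_natr; ring.
exists w, E; split=> //.
- move=> [k|b] /=.
    by case: (0 < k)%N => /=; lra.
  have W0 : 0 <= W - 3 by rewrite subr_ge0.
  have mW : m%:R * (W - 3) <= 1.
    by apply: le_trans denomW; rewrite ler_wpM2r // ler_nat leq_maxl.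
  have nW : (n - m.+1)%:R * (W - 3) <= 1.
    by apply: le_trans denomW; rewrite ler_wpM2r // ler_nat leq_maxr.
  by case: b; rewrite subr_ge0.
- have mlen : (m <= n)%N by lia.
  move=> [k|b]; apply: (basepoint_free_Ydiv n_le (sum_al _)) => //.
  + by rewrite setCK cards1 addn1.
  + exact: leq_addr.
  + by rewrite setCT cards0 addn0; case: b; rewrite ?addn1 ?addn0.
- move=> i /(Y_pic_eqP n_le)[]; rewrite xE [RHS]big1 // => /eqP.
  by case: i => [k|[]]; rewrite pnatr_eq0; lia.
apply/(Y_pic_eqP n_le); rewrite x_deg_sum; split=> [|j].
  rewrite x_deg_int x_degD mulrz_nat.
  under eq_bigr do rewrite xE mulrz_nat.
  rewrite big_sumType /= big_bool /= -mulr_suml.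
  have := sumw; rewrite big_sumType /= big_bool /= => sumW.
  rewrite (_ : \sum_i _ = W - (w (inr true) + w (inr false))); last first.
    by rewrite -[in RHS]sumW addrK.
  by rewrite /= -natr1 natrD natrM; ring.
rewrite pair_deg_sum pair_deg_int pair_degD mulrz_nat.
rewrite (eq_bigr (fun i => w i - (if i == inl j then w i else 0))) => [|i _].
  by rewrite sumrB sumw -big_mkcond big_pred1_eq /= natrD; ring.
case: i => [k|b]; rewrite pair_deg_Ydiv mulrz_nat !inE; last first.
  by rewrite mulr1 subr0.
rewrite (_ : (inl k == inl j :> 'I_n + bool) = (k == j)) // eq_sym.
by case: eqP => _; rewrite ?mulr0 ?mulr1 ?subrr ?subr0.
Qed.
End OnY.
End Decompositions.

(** * Gongyo indices of the lifts of Y *)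

Section LiftTau.
Variables (m n : nat) (F : fan).
Variables (pi : ray F -> ray (Yfan m n)) (sec : ray (Yfan m n) -> ray F).
Hypothesis liftF : fan_lift pi sec.
Hypotheses (m_gt0 : (0 < m)%N) (mn : (m + 2 <= n)%N) (n_le : (n <= m.*2.+2)%N).
Hypotheses
  (x_degK : x_deg (push_div pi (anticanonical F)) = (3 * m + 1)%:R)
  (pair_degK : forall i : 'I_n,
    pair_deg (push_div pi (anticanonical F)) i = (2 + (0 < i))%N%:R).

Lemma tau_lift (R : realType) (K : realDomainType) (emb : K -> R) (W : K) :
  3 <= W -> (tau_denom m n)%:R * (W - 3) <= 1 ->
  (forall W', (tau_denom m n)%:R * (W' - 3) <= 1 -> emb W' <= emb W) ->
  tau_div emb (anticanonical F) = (emb W)%:E.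
Proof.
move=> W3 denomW Wmax; apply/eqP; rewrite eq_le; apply/andP; split.
  apply: ge_ereal_sup => _ [k [a [E [dec ->]]]]; rewrite lee_fin; apply: Wmax.
  exact: weight_le m_gt0 mn n_le _ x_degK pair_degK _ _ _
    (nef_decomposition_push liftF dec).
have [w [E [w_ge0 bpfE nzE sumw eqE]]] :=
  exists_nef_decomposition m_gt0 mn n_le x_degK pair_degK W3 denomW.
apply: ereal_sup_ubound.
have pushK i : push_div pi (pull_div pi sec (E i)) = E i by exact: pull_divK.
have [||||k [a [E' [dec sum_a]]]] := @nef_decomposition_of_weights K F
    (anticanonical F) _ w (fun i => pull_div pi sec (E i)).
- exact: w_ge0.
- move=> i; apply: basepoint_free_nef; apply: (basepoint_free_lift liftF).
  by rewrite pushK.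
- by move=> i; apply/(push_div_nonzero liftF); rewrite pushK.
- apply/(pic_eq_sum_push liftF); apply: pic_eq_ext eqE => // r.
  by apply: eq_bigr => i _; rewrite pushK.
by exists k, a, E'; rewrite sum_a sumw.
Qed.

Lemma tauQ_lift (R : realType) :
  tauQ R F = (3 + 1 / (tau_denom m n)%:R : R)%:E.
Proof.
have s_gt0 (K : numDomainType) : 0 < (tau_denom m n)%:R :> K.
  by rewrite ltr0n leq_max m_gt0.
have -> : 3 + 1 / (tau_denom m n)%:R = ratr (3 + 1 / (tau_denom m n)%:R) :> R.
  by rewrite rmorphD fmorph_div !rmorph_nat rmorph1.
apply: (tau_lift (emb := fun q : rat => ratr q)).
- by rewrite lerDl divr_ge0 // ltW.
- by rewrite (addrC 3) addrK mul1r divff ?lt0r_neq0 ?s_gt0.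
- by move=> W' hW'; rewrite ler_rat -lerBlDl ler_pdivlMr ?s_gt0 // mulrC.
Qed.

Lemma tauZ_lift (R : realType) :
  tauZ R F = (if tau_denom m n == 1%N then 4 else 3)%:E.
Proof.
have s_gt0 : (0 < tau_denom m n)%N by rewrite leq_max m_gt0.
have -> : (if tau_denom m n == 1%N then 4 else 3) =
    (if tau_denom m n == 1%N then 4 else 3 : int)%:~R :> R by case: ifP.
apply: (tau_lift (emb := fun z : int => z%:~R)).
- by case: ifP.
- case: ifP => [/eqP ->|_] //; by rewrite subrr mulr0.
move=> W' hW'; rewrite ler_int; case: eqP hW' => [->|s1] hW'; nia.
Qed.

End LiftTau.

(** Each [x_i] with [i] in [T] and each [y_j] with [j > 0] outside [T] is
    doubled once, so exactly one ray of each pair of positive index is. *)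
Lemma Yhat_lift (m n : nat) (T : {set 'I_n}) (s : seq (Y_ray m n)) :
  (n <= m.*2.+2)%N -> (0 < n)%N -> T \subset idx_ge2 n ->
  perm_eq s (lifted_rays m T) ->
  exists (pi : ray (Yhat s) -> ray (Yfan m n)) sec,
  [/\ fan_lift pi sec,
      x_deg (push_div pi (anticanonical (Yhat s))) = (m.*2.+2 + #|T|)%:R &
      forall i : 'I_n, pair_deg (push_div pi (anticanonical (Yhat s))) i =
        (2 + (0 < i))%N%:R].
Proof.
move=> n_le n_gt0 /subsetP T2 hs.
have xiI := x_idx_inj n_le.
have inx i : (inl i \in s) = (i \in @x_idx m n @: T).
  rewrite (perm_mem hs) mem_cat [X in _ || X](_ : _ = false) ?orbF.
    apply/mapP/imsetP => -[j]; rewrite ?mem_enum => jT.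
      by case=> ->; exists j.
    by move=> ->; exists j; rewrite ?mem_enum.
  by apply/mapP => -[].
have iny j : (inr j \in s) = (j \in idx_ge2 n :\: T).
  rewrite (perm_mem hs) mem_cat [X in X || _](_ : _ = false) /=; last first.
    by apply/mapP => -[].
  by rewrite mem_map ?mem_enum // => a b [].
have s_uniq : uniq s.
  rewrite (perm_uniq hs) cat_uniq !map_inj_uniq ?enum_uniq ?andbT /=.
  - by apply/hasPn => r /mapP[j _ ->]; apply/mapP => -[].
  - by move=> a b [].
  - by move=> a b [] /xiI.
have [pi [sec [liftF cnt]]] :=
  fan_lift_H2_seq s (id : Y_ray m n -> ray (Yfan m n)).
have Kmult r : push_div pi (anticanonical (Yhat s)) r = (r \in s).+1%:R.
  rewrite ffunE -count_uniq_mem // -cnt.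
  by apply: eq_bigr => r' _; rewrite ffunE.
exists pi, sec; split=> // [|i].
  rewrite /x_deg; under eq_bigr do rewrite Kmult inx -addn1 natrD.
  rewrite big_split /= sum_indicator card_imset // sumr_const card_ord.
  by rewrite addrC -natrD.
rewrite /pair_deg !Kmult inx iny /x_ray mem_imset // !inE -natrD.
congr (_%:R); have := T2 i; rewrite inE.
by case: (i \in T) => [->|_] //; case: (0 < i)%N.
Qed.

Theorem theorem5p14 (R : realType) (m n : nat) (T : {set 'I_n})
    (s : seq (Y_ray m n))
    (hm : (1 <= m)%N) (hn : (m + 2 <= n <= 2 * m + 2)%N)
    (hT : T \subset idx_ge2 n) (hcT : #|T| = (m - 1)%N)
    (hs : perm_eq s (lifted_rays m T)) :
  [/\ (m, n) = (1, 3)%N ->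
        (tauZ R (Yhat s), tauQ R (Yhat s)) = (4%:E, 4%:E),
      (2 <= m)%N -> (m + 2 <= n <= 2 * m + 1)%N ->
        (tauZ R (Yhat s), tauQ R (Yhat s)) = (3%:E, (3 + 1 / m%:R)%:E),
      n = (2 * m + 2)%N ->
        (tauZ R (Yhat s), tauQ R (Yhat s)) = (3%:E, (3 + 1 / (m + 1)%:R)%:E)
    & (0 < delta R (Yhat s))%E <-> (m, n) <> (1, 3)%N].
Proof.
have [mn n_le2] := andP hn.
have n_le : (n <= m.*2.+2)%N by rewrite -addnn; lia.
have n_gt0 : (0 < n)%N by lia.
have [pi [sec [liftF xK fK]]] := Yhat_lift n_le n_gt0 hT hs.
have {}xK : x_deg (push_div pi (anticanonical (Yhat s))) = (3 * m + 1)%:R.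
  by rewrite xK hcT -addnn; congr (_%:R); lia.
have tZ : tauZ R (Yhat s) = _ := tauZ_lift liftF hm mn n_le xK fK R.
have tQ : tauQ R (Yhat s) = _ := tauQ_lift liftF hm mn n_le xK fK R.
have denomE : tau_denom m n = (if n == 2 * m + 2 then m + 1 else m)%N.
  by rewrite /tau_denom; case: eqP => ?; lia.
have denom1 : tau_denom m n = 1%N <-> (m, n) = (1, 3)%N.
  rewrite denomE; split=> [|[-> ->]] //.
  by case: eqP => // ? ?; congr (_, _); lia.
rewrite tZ tQ; split.
- by move=> /denom1 ->; congr (_, _%:E); rewrite divr1 natr1.
- move=> m2 /andP[_ n2].
  have -> : tau_denom m n = m by rewrite denomE; case: eqP => // ?; lia.
  by rewrite gtn_eqF.
- move=> en.
  have -> : tau_denom m n = (m + 1)%N by rewrite denomE en eqxx.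
  by rewrite gtn_eqF // addn1.
have -> : delta R (Yhat s) = (tauQ R (Yhat s) - tauZ R (Yhat s))%E by [].
rewrite tZ tQ -EFinB lte_fin -denom1.
have s_gt0 : 0 < (tau_denom m n)%:R :> R by rewrite ltr0n leq_max hm.
case: (tau_denom m n =P 1%N) => [->|s1]; split=> // h.
- by move: h; rewrite divr1 natr1 subrr ltxx.
- by rewrite (addrC 3) addrK mul1r invr_gt0.
Qed.
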